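(* Let $\mathcal Y$ be a metric space, let $\mathcal U$ be a subset of a Hilbert space $\mathcal T$, and for each $y\in\mathcal Y$ let $F_y:\mathcal M\times\mathcal U\to\mathbb R$. Let $\theta:\mathcal M\times\mathcal U\to\mathbb R$ be given by $\theta(P',u')=\inf_{y\in\mathcal Y}F_y(P',u')$. Fix $(P,u)\in\mathcal M\times\mathcal U$ and suppose $\mathcal M$ is locally nonparametric at $P$. Suppose: (i) $\mathcal Y$ is a compact metric space; (ii) there exists a unique $y(0)\in\mathcal Y$ such that $\theta(P,u)=F_{y(0)}(P,u)$; (iii) $\{F_y:y\in\mathcal Y\}$ is uniformly totally pathwise differentiable at $(y(0),P,u)$; (iv) for all $s\in\check{\mathcal M}_P$ and $t\in\check{\mathcal U}_u$, $y\mapsto\dot F_{y,P,u}(s,t)$ is continuous at $y(0)$; and (v) there exists a neighborhood $\mathcal N$ of $(P,u)$ in $\mathcal M\times\mathcal U$ such that $(y,P',u')\mapsto F_y(P',u')$ is continuous on $\mathcal Y\times\mathcal N$. Then $\theta$ is totally pathwise differentiable at $(P,u)$ with $\dot\theta_{P,u}=\dot F_{y(0),P,u}$ and $\dot\theta_{P,u}^*=\dot F_{y(0),P,u}^*$.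
   Context: All Hilbert spaces are real. $\mathcal M$ is a set of probability distributions on a measurable space $\mathcal Z$; $\mathcal M\times\mathcal U$ carries the product topology of the Hellinger metric on $\mathcal M$ and the $\|\cdot\|_{\mathcal T}$-metric on $\mathcal U$. For $P\in\mathcal M$ and $s\in L^2(P)$, $\mathscr P(P,\mathcal M,s)$ is the collection of submodels $\{P_\epsilon:\epsilon\in[0,1]\}\subseteq\mathcal M$ with $P_{\epsilon=0}=P$ that are quadratic mean differentiable with score $s$ at $\epsilon=0$, i.e. $\int(\sqrt{dP_\epsilon}-\sqrt{dP}-\tfrac{\epsilon}{2}s\sqrt{dP})^2=o(\epsilon^2)$ as $\epsilon\to0$. The tangent set is $\check{\mathcal M}_P=\{s\in L^2(P):\mathscr P(P,\mathcal M,s)\neq\emptyset\}$ and the tangent space $\dot{\mathcal M}_P$ is the $L^2(P)$-closure of its linear span. $\mathcal M$ is locally nonparametric at $P$ if $\dot{\mathcal M}_P=\{s\in L^2(P):\int s\,dP=0\}$. For $u\in\mathcal U$, $t\in\mathcal T$, $\mathscr P(u,\mathcal U,t)$ is the set of paths $\{u_\epsilon:\epsilon\in[0,1]\}\subseteq\mathcal U$ with $\|u_\epsilon-u-\epsilon t\|_{\mathcal T}=o(\epsilon)$; $\check{\mathcal U}_u=\{t\in\mathcal T:\mathscr P(u,\mathcal U,t)\ne\emptyset\}$ and $\dot{\mathcal U}_u$ is the $\mathcal T$-closure of its linear span. A map $\theta:\mathcal M\times\mathcal U\to\mathcal W$ ($\mathcal W$ Hilbert) is totally pathwise differentiable at $(P,u)$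 if there is a continuous linear $\dot\theta_{P,u}:\dot{\mathcal M}_P\oplus\dot{\mathcal U}_u\to\mathcal W$ such that for all $s\in\check{\mathcal M}_P$, $t\in\check{\mathcal U}_u$, $\{P_\epsilon\}\in\mathscr P(P,\mathcal M,s)$, $\{u_\epsilon\}\in\mathscr P(u,\mathcal U,t)$, $\|\theta(P_\epsilon,u_\epsilon)-\theta(P,u)-\epsilon\,\dot\theta_{P,u}(s,t)\|_{\mathcal W}=o(\epsilon)$. Its Hermitian adjoint is $\dot\theta_{P,u}^*:\mathcal W\to\dot{\mathcal M}_P\oplus\dot{\mathcal U}_u$. If $F_y$ is totally pathwise differentiable at $(P,u)$, its differential operator and adjoint are written $\dot F_{y,P,u}$, $\dot F_{y,P,u}^*$. $\{F_y:y\in\mathcal Y\}$ is uniformly totally pathwise differentiable at $(y(0),P,u)$ if there is a neighborhood of $y(0)$ such that $F_y$ is totally pathwise differentiable at $(P,u)$ for all $y$ in it and, for all $s\in\check{\mathcal M}_P$, $t\in\check{\mathcal U}_u$, $\{P_\epsilon\}\in\mathscr P(P,\mathcal M,s)$, $\{u_\epsilon\}\in\mathscr P(u,\mathcal U,t)$, $\lim_{(y,\epsilon)\to(y(0),0)}\big([F_y(P_\epsilon,u_\epsilon)-F_y(P,u)]/\epsilon-\dot F_{y,P,u}(s,t)\big)=0$. *)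

(* Defs.v *)
From HB Require Import structures.
From mathcomp Require Import all_boot all_order all_algebra.
From mathcomp Require Import sesquilinear.
From mathcomp Require Import all_classical all_reals all_analysis.
From mathcomp Require Import measurable_realfun.
Set Implicit Arguments.
Unset Strict Implicit.
Unset Printing Implicit Defensive.
Import Order.TTheory GRing.Theory Num.Theory.
Import numFieldNormedType.Exports.
Local Open Scope classical_set_scope.
Local Open Scope ring_scope.

HB.mixin Record NormedModule_hasInner (R : realType) V & NormedModule R V := {
  inner : {dot V for (@idfun R)} ;
  inner_norm : forall x : V, inner x x = `|x| ^+ 2
}.

#[short(type="innerModType")]
HB.structure Definition InnerModule (R : realType) :=
  {V of NormedModule R V & NormedModule_hasInner R V}.

#[short(type="hilbertType")]
HB.structure Definition Hilbert (R : realType) :=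
  {V of InnerModule R V & Complete V}.

Section real_inner.
Variable R : realType.

Definition rinner (x y : R^o) : R := x * y.

Let rinner_bilinear :
  bilinear_for (GRing.Scale.Law.clone _ _ *%R _)
    (GRing.Scale.Law.clone _ _ (@idfun R \; *%R) _) rinner.
Proof.
split=> [y a x x'|x a y y'] /=; rewrite /rinner.
  by rewrite mulrDl -mulrA.
by rewrite mulrDr /= mulrCA.
Qed.

HB.instance Definition _ := bilinear_isBilinear.Build R R^o R^o R
  (GRing.Scale.Law.clone _ _ *%R _)
  (GRing.Scale.Law.clone _ _ (@idfun R \; *%R) _) rinner rinner_bilinear.

Let rinner_sym (x y : R^o) : rinner x y = (-1) ^+ false * idfun (rinner y x).
Proof. by rewrite expr0 mul1r /= /rinner mulrC. Qed.

HB.instance Definition _ :=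
  isHermitianSesquilinear.Build R R^o false idfun rinner rinner_sym.

Let rinner_gt0 (x : R^o) : x != 0 -> 0 < rinner x x.
Proof. by move=> x0; rewrite /rinner -expr2 exprn_even_gt0. Qed.

HB.instance Definition _ := isDotProduct.Build R R^o rinner rinner_gt0.

Let rinner_norm (x : R^o) : rinner x x = `|x| ^+ 2.
Proof. by rewrite -normrX ger0_norm ?sqr_ge0 // expr2. Qed.

HB.instance Definition _ := NormedModule_hasInner.Build R R^o rinner_norm.

End real_inner.

(* The library's L^2(mu), a quotient by almost-everywhere equality, comes with
   no vector space structure. *)
Section L2_structure.
Context d (Z : measurableType d) (R : realType).
Variable mu : {measure set Z -> \bar R}.

Definition L2 := LspaceType mu (lee1n 2).
Implicit Types f g h : L2.

HB.instance Definition _ := gen_eqMixin L2.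
HB.instance Definition _ := gen_choiceMixin L2.

Local Notation Lf := (LfunType mu (lee1n 2)).
Implicit Types u v : Lf.

Definition L2_mfun f : {mfun Z >-> measurableTypeR R} :=
  repr (LebesgueSpace.sort f : {mfun_ mu, Z >-> measurableTypeR R}).

Definition L2_fun f : Z -> R := L2_mfun f.

Let L2_fun_Lfun f : L2_fun f \in Lfun mu 2.
Proof.
apply/andP; split; first by rewrite inE; exact: (@measurable_funPT _ _ _ _ (L2_mfun f)).
rewrite inE /=; case: f => f [[ff]]; exact: ff.
Qed.

Definition L2_rep f : Lf := Lfun_Sub (lee1n 2) (L2_fun_Lfun f).

Let eq_mfunP (a b : {mfun Z >-> measurableTypeR R}) :
  (\pi_({mfun_ mu, Z >-> measurableTypeR R})%qT a = \pi b)%qT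
  <-> ((a : Z -> R) = b %[ae mu]).
Proof.
split; first by move=> /eqmodP /asboolP.
by move=> ab; apply/eqmodP/asboolP.
Qed.

Lemma L2P f g : f = g <-> (L2_fun f = L2_fun g %[ae mu]).
Proof.
split; first by move=> ->; exact: ae_eq_refl.
move=> fg.
have : LebesgueSpace.sort f = LebesgueSpace.sort g.
  have /eq_mfunP fg' := fg.
  exact: etrans (esym (reprK _)) (etrans fg' (reprK _)).
case: f g {fg} => [f [[ff]]] [g [[gg]]] /= fg; case: _ / fg in gg *.
by rewrite (Prop_irrelevance ff gg).
Qed.

Let ae_Lnorm (a b : Z -> R) : measurable_fun setT a -> measurable_fun setT b ->
  a = b %[ae mu] -> ('N[mu]_2[EFin \o a] = 'N[mu]_2[EFin \o b])%E.
Proof.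
move=> ma mb ab; rewrite unlock /Lnorm; congr (_ `^ _)%E.
apply: ae_eq_integral => //.
- apply: (@measurableT_comp _ _ _ _ _ _ (fun x => x `^ 2)%E).
    exact: measurable_poweR.
  by apply: measurableT_comp => //; exact/measurable_EFinP.
- apply: (@measurableT_comp _ _ _ _ _ _ (fun x => x `^ 2)%E).
    exact: measurable_poweR.
  by apply: measurableT_comp => //; exact/measurable_EFinP.
- by apply: filterS ab => x /= abx _; rewrite abx.
Qed.

Let ae_finite_norm (a b : Z -> R) : measurable_fun setT a ->
  measurable_fun setT b -> a = b %[ae mu] ->
  finite_norm mu 2 a -> finite_norm mu 2 b.
Proof. by move=> ma mb ab; rewrite /finite_norm (ae_Lnorm ma mb ab). Qed.

Let Lf_measurable u : (u : Z -> measurableTypeR R) \in mfun.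
Proof. by rewrite inE; exact: (@measurable_funPT _ _ _ _ u). Qed.

Let mkL2_finite u :
  finite_norm mu 2 (repr (\pi_({mfun_ mu, Z >-> measurableTypeR R})%qT
    (mfun_Sub (Lf_measurable u)))).
Proof.
set v := repr _.
have mv : measurable_fun setT (v : Z -> R) by exact: (@measurable_funPT _ _ _ _ v).
have mu' : measurable_fun setT (u : Z -> R) by exact: (@measurable_funPT _ _ _ _ u).
have uv : (u : Z -> R) = v %[ae mu].
  apply: ae_eq_sym.
  by apply: (eq_mfunP v (mfun_Sub (Lf_measurable u))).1; exact: reprK.
exact: (ae_finite_norm mu' mv uv (@Lfunction_finite _ _ _ _ _ _ u)).
Qed.

Definition mkL2 u : L2 := @LebesgueSpace.Pack _ _ _ _ _ _
  (\pi_({mfun_ mu, Z >-> measurableTypeR R})%qT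
     (mfun_Sub (Lf_measurable u)))
  (LebesgueSpace.Class (isFinLebesgue.Build _ _ _ _ _ (lee1n 2) _ (mkL2_finite u))).

Lemma mkL2K u : L2_fun (mkL2 u) = u %[ae mu].
Proof. by apply: (eq_mfunP _ (mfun_Sub (Lf_measurable u))).1; exact: reprK. Qed.

Definition L2_add f g := mkL2 (L2_rep f + L2_rep g).
Definition L2_opp f := mkL2 (- L2_rep f).
Definition L2_scale (a : R) f := mkL2 (a *: L2_rep f).
Definition L2_zero := mkL2 0.

Let ae_step (a b : Z -> R) (Q : Z -> Prop) : a = b %[ae mu] ->
  {ae mu, forall x, a x = b x -> Q x} -> {ae mu, forall x, Q x}.
Proof. by move=> ab; apply: filterS2 ab => x abx; apply; exact: abx. Qed.

Let L2_ext f g : {ae mu, forall x, L2_fun f x = L2_fun g x} -> f = g.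
Proof. by move=> fg; apply/L2P; apply: filterS fg => x fgx _. Qed.

Local Ltac ae H := apply: (ae_step H).

Lemma L2_addE f g :
  L2_fun (L2_add f g) = (fun x => L2_fun f x + L2_fun g x) %[ae mu].
Proof. exact: mkL2K. Qed.

Lemma L2_oppE f : L2_fun (L2_opp f) = (fun x => - L2_fun f x) %[ae mu].
Proof. exact: mkL2K. Qed.

Lemma L2_scaleE a f : L2_fun (L2_scale a f) = (fun x => a * L2_fun f x) %[ae mu].
Proof. exact: mkL2K. Qed.

Lemma L2_zeroE : L2_fun L2_zero = (fun=> 0) %[ae mu].
Proof. exact: mkL2K. Qed.

Let L2_addA : associative L2_add.
Proof.
move=> f g h; apply: L2_ext.
ae (L2_addE f g); ae (L2_addE (L2_add f g) h); ae (L2_addE g h);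
ae (L2_addE f (L2_add g h)).
apply: nearW => x -> -> -> ->.
by rewrite addrA.
Qed.

Let L2_addC : commutative L2_add.
Proof.
move=> f g; apply: L2_ext.
ae (L2_addE g f); ae (L2_addE f g).
apply: nearW => x -> ->.
by rewrite addrC.
Qed.

Let L2_add0 : left_id L2_zero L2_add.
Proof.
move=> f; apply: L2_ext.
ae L2_zeroE; ae (L2_addE L2_zero f).
apply: nearW => x -> ->.
by rewrite add0r.
Qed.

Let L2_addN : left_inverse L2_zero L2_opp L2_add.
Proof.
move=> f; apply: L2_ext.
ae L2_zeroE; ae (L2_oppE f); ae (L2_addE (L2_opp f) f).
apply: nearW => x -> -> ->.
by rewrite addNr.
Qed.

HB.instance Definition _ :=
  GRing.isZmodule.Build L2 L2_addA L2_addC L2_add0 L2_addN.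

Lemma L2DE f g : L2_fun (f + g) = (fun x => L2_fun f x + L2_fun g x) %[ae mu].
Proof. exact: L2_addE. Qed.

Let L2_scaleA a b f : L2_scale a (L2_scale b f) = L2_scale (a * b) f.
Proof.
apply: L2_ext.
ae (L2_scaleE (a * b) f); ae (L2_scaleE b f); ae (L2_scaleE a (L2_scale b f)).
apply: nearW => x -> -> ->.
by rewrite mulrA.
Qed.

Let L2_scale1 : left_id 1 L2_scale.
Proof.
move=> f; apply: L2_ext.
ae (L2_scaleE 1 f).
apply: nearW => x ->.
by rewrite mul1r.
Qed.

Let L2_scaleDr : right_distributive L2_scale +%R.
Proof.
move=> a f g; apply: L2_ext.
ae (L2_scaleE a g); ae (L2_scaleE a f);
ae (L2DE (L2_scale a f) (L2_scale a g)); ae (L2DE f g); ae (L2_scaleE a (f + g)).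
apply: nearW => x -> -> -> -> ->.
by rewrite mulrDr.
Qed.

Let L2_scaleDl f : {morph L2_scale^~ f : a b / a + b}.
Proof.
move=> a b; apply: L2_ext.
ae (L2_scaleE b f); ae (L2_scaleE a f); ae (L2DE (L2_scale a f) (L2_scale b f));
ae (L2_scaleE (a + b) f).
apply: nearW => x -> -> -> ->.
by rewrite mulrDl.
Qed.

HB.instance Definition _ := GRing.Zmodule_isLmodule.Build R L2
  L2_scaleA L2_scale1 L2_scaleDr L2_scaleDl.

Lemma L2ZE a f : L2_fun (a *: f) = (fun x => a * L2_fun f x) %[ae mu].
Proof. exact: L2_scaleE. Qed.

Definition L2_inner f g : R := \int[mu]_x (L2_fun f x * L2_fun g x).

Definition L2_norm f : R := fine ('N[mu]_2[EFin \o L2_fun f])%E.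

Lemma L2_integrableM f g :
  mu.-integrable setT (EFin \o (fun x => L2_fun f x * L2_fun g x)).
Proof. by apply/Lfun1_integrable; apply: Lfun2_mul_Lfun1. Qed.

Let ae_Rintegral (a b : Z -> R) :
  mu.-integrable setT (EFin \o a) -> mu.-integrable setT (EFin \o b) ->
  a = b %[ae mu] -> \int[mu]_x a x = \int[mu]_x b x.
Proof.
move=> /measurable_int ma /measurable_int mb ab; congr fine.
by apply: ae_eq_integral => //; apply: filterS ab => x /= abx _; rewrite abx.
Qed.

Lemma L2_innerC f g : L2_inner f g = L2_inner g f.
Proof. by apply: eq_Rintegral => x _; rewrite mulrC. Qed.

Lemma L2_inner_linear f : linear_for *%R (L2_inner f).
Proof.
move=> a g h; rewrite /L2_inner.
have I1 := L2_integrableM f g; have I2 := L2_integrableM f h.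
have I3 : mu.-integrable setT
    (EFin \o (fun x => a * (L2_fun f x * L2_fun g x))).
  exact: (@integrableZl _ _ _ mu setT measurableT a
    (EFin \o (fun x => L2_fun f x * L2_fun g x)) I1).
rewrite -RintegralZl // -RintegralD //.
apply: ae_Rintegral; first exact: L2_integrableM.
  exact: (@integrableD _ _ _ mu setT measurableT _ _ I3 I2).
ae (L2ZE a g); ae (L2DE (a *: g) h).
apply: nearW => x -> ->.
by rewrite mulrDr mulrCA.
Qed.

Let L2_normE f : (L2_norm f)%:E = ('N[mu]_2[EFin \o L2_fun f])%E.
Proof. exact: (@finite_norm_fine _ _ _ mu 2 (lee1n 2) (L2_rep f)). Qed.

Lemma L2_norm_ge0 f : 0 <= L2_norm f.
Proof. by rewrite -lee_fin L2_normE Lnorm_ge0. Qed.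

Lemma L2_inner_norm f : L2_inner f f = L2_norm f ^+ 2.
Proof.
have n2 : 2 != 0 :> R by [].
have := powR_Lnorm mu (EFin \o L2_fun f) n2.
rewrite -L2_normE poweR_EFin (@powR_mulrn _ _ 2) ?L2_norm_ge0 //.
move=> /(congr1 fine) /= ->; congr fine; apply: eq_integral => x _.
by rewrite /= (@powR_mulrn _ _ 2) // -normrX ger0_norm ?sqr_ge0 // expr2.
Qed.

Lemma L2_norm_eq0 f : L2_norm f = 0 -> f = 0.
Proof.
move=> /(@fine_Lnormr_eq0 _ _ _ mu 2 (lee1n 2) (L2_rep f)) f0; apply: L2_ext.
ae L2_zeroE; ae (f0 : L2_fun f = (fun=> 0) %[ae mu]).
apply: nearW => x -> -> //.
Qed.

Lemma L2_normD f g : L2_norm (f + g) <= L2_norm f + L2_norm g.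
Proof.
have mfg : measurable_fun setT (L2_rep f + L2_rep g : Z -> R).
  exact: (@measurable_funPT _ _ _ _ (L2_rep f + L2_rep g)).
have E := ae_Lnorm (@measurable_funPT _ _ _ _ (L2_rep (f + g))) mfg (L2DE f g).
apply: le_trans (@ler_LnormD _ _ _ mu 2 (lee1n 2) (L2_rep f) (L2_rep g)).
by rewrite /L2_norm (E : _ = _).
Qed.

Lemma L2_normZ a f : L2_norm (a *: f) = `|a| * L2_norm f.
Proof.
have maf : measurable_fun setT (a *: L2_rep f : Z -> R).
  exact: (@measurable_funPT _ _ _ _ (a *: L2_rep f)).
have E := ae_Lnorm (@measurable_funPT _ _ _ _ (L2_rep (a *: f))) maf (L2ZE a f).
apply: EFin_inj; rewrite EFinM !L2_normE.
by rewrite -(@LnormZ _ _ _ mu 2 (lee1n 2) (L2_rep f) a); exact: E.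
Qed.

HB.instance Definition _ := Lmodule_isNormed.Build R L2
  L2_normD L2_normZ L2_norm_eq0.

Let L2_inner_bilinear :
  bilinear_for (GRing.Scale.Law.clone _ _ *%R _)
    (GRing.Scale.Law.clone _ _ (@idfun R \; *%R) _) L2_inner.
Proof.
split=> [g a f f'|f a g g'] /=; last exact: L2_inner_linear.
by rewrite !(L2_innerC _ g); exact: L2_inner_linear.
Qed.

HB.instance Definition _ := bilinear_isBilinear.Build R L2 L2 R
  (GRing.Scale.Law.clone _ _ *%R _)
  (GRing.Scale.Law.clone _ _ (@idfun R \; *%R) _) L2_inner L2_inner_bilinear.

Let L2_inner_sym f g : L2_inner f g = (-1) ^+ false * idfun (L2_inner g f).
Proof. by rewrite expr0 mul1r L2_innerC. Qed.

HB.instance Definition _ :=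
  isHermitianSesquilinear.Build R L2 false idfun L2_inner L2_inner_sym.

Let L2_inner_gt0 f : f != 0 -> 0 < L2_inner f f.
Proof.
move=> f0; rewrite L2_inner_norm exprn_gt0 // lt_neqAle L2_norm_ge0 andbT eq_sym.
by apply: contra_neq f0 => /L2_norm_eq0.
Qed.

HB.instance Definition _ := isDotProduct.Build R L2 L2_inner L2_inner_gt0.

HB.instance Definition _ := NormedModule_hasInner.Build R L2 L2_inner_norm.

End L2_structure.

Section dominating_measure.
Context d (Z : measurableType d) (R : realType).
Variables P Q : {finite_measure set Z -> \bar R}.

Definition dom_measure : set Z -> \bar R := measure_add P Q.

HB.instance Definition _ := Measure.on dom_measure.

Let dom_measure_fin : fin_num_fun dom_measure.
Proof.
move=> A mA.
by rewrite /dom_measure /= measure_addE fin_numD !fin_num_measure.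
Qed.

HB.instance Definition _ :=
  @Measure_isFinite.Build _ Z R dom_measure dom_measure_fin.

End dominating_measure.

(* sqrt (dP/dmu), determined mu-a.e. when P << mu *)
Definition root_density d (Z : measurableType d) (R : realType)
    (P : {finite_measure set Z -> \bar R})
    (mu : {sigma_finite_measure set Z -> \bar R}) (z : Z) : R :=
  Num.sqrt (fine (Radon_Nikodym (charge_of_finite_measure P) mu z)).

Section models.
Context d (Z : measurableType d) (R : realType).
Local Notation prob := (probability Z R).
Implicit Types (P Q : prob) (M : set prob).

(* The value does not depend on the choice of the dominating measure P + Q;
   some authors insert a factor 1/2, which does not change the topology. *)
Definition hellinger P Q : R :=
  let mu := dom_measure P Q in
  Num.sqrt (\int[mu]_z (root_density P mu z - root_density Q mu z) ^+ 2).

Definition hellinger_nbhs P : set_system prob :=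
  filter_from [set e : R | 0 < e] (fun e => [set Q | hellinger P Q < e]).

Definition qmd_remainder P (s : L2 P) (e : R) Q : R :=
  let mu := dom_measure P Q in
  \int[mu]_z (root_density Q mu z - root_density P mu z
              - e / 2 * L2_fun s z * root_density P mu z) ^+ 2.

Definition score_paths P M (s : L2 P) : set (R -> prob) :=
  [set Pe | [/\ forall e, 0 <= e <= 1 -> M (Pe e), Pe 0 = P &
    qmd_remainder s e (Pe e) / e ^+ 2 @[e --> 0^'+] --> (0 : R)]].

Definition tangent_set P M : set (L2 P) :=
  [set s | score_paths M s !=set0].

End models.
Arguments tangent_set {d Z R} P M.

Definition linear_span (R : realType) (V : normedModType R) (A : set V) : set V :=
  [set x | exists n (a : 'I_n -> R) (v : 'I_n -> V),
    (forall i, A (v i)) /\ x = \sum_(i < n) a i *: v i].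

Section tangent.
Context d (Z : measurableType d) (R : realType).
Local Notation prob := (probability Z R).

Definition tangent_space (P : prob) (M : set prob) : set (L2 P) :=
  closure (linear_span (tangent_set P M)).

Arguments tangent_space P M : clear implicits.

Definition locally_nonparametric (P : prob) (M : set prob) : Prop :=
  tangent_space P M = [set s : L2 P | \int[P]_z L2_fun s z = 0].

(* The value of the path at 0 is not constrained: nothing below depends on it. *)
Definition direction_paths (T : hilbertType R) (u : T) (U : set T) (t : T) :
    set (R -> T) :=
  [set ue | (forall e, 0 <= e <= 1 -> U (ue e)) /\
    `|ue e - u - e *: t| / e @[e --> 0^'+] --> (0 : R)].

Definition direction_set (T : hilbertType R) (u : T) (U : set T) : set T :=
  [set t | direction_paths u U t !=set0].

Definition direction_space (T : hilbertType R) (u : T) (U : set T) : set T :=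
  closure (linear_span (direction_set u U)).

Definition tangent_sum (T : hilbertType R) (M : set prob) (U : set T)
    (P : prob) (u : T) : set (L2 P * T) :=
  tangent_space P M `*` direction_space u U.
Arguments tangent_sum {T} M U P u.

Section total_pathwise_derivative.
Variables (T W : hilbertType R) (M : set prob) (U : set T).
Variables (P : prob) (u : T) (theta : prob -> T -> W).
Local Notation H := (tangent_sum M U P u).

(* An operator on the closed subspace [H] is represented by a function on the
   ambient space, of which only the restriction to [H] is constrained. *)
Definition is_total_derivative (D : L2 P * T -> W) : Prop :=
  [/\ forall a h k, H h -> H k -> D (a *: h + k) = a *: D h + D k,
      {within H, continuous D} &
      forall s t, tangent_set P M s -> direction_set u U t ->
      forall Pe ue, score_paths M s Pe -> direction_paths u U t ue ->
        `|theta (Pe e) (ue e) - theta P u - e *: D (s, t)| / e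
          @[e --> 0^'+] --> (0 : R)].

Definition totally_pathwise_differentiable : Prop :=
  exists D, is_total_derivative D.

(* Like the library's 'd f x, a choice among the functions satisfying the
   predicate.  All of them agree on [tangent_sum M U P u], since they are
   linear and continuous there and prescribed on the (s, 0) and (0, t); values
   elsewhere are meaningless. *)
Definition total_derivative : L2 P * T -> W := get is_total_derivative.

End total_pathwise_derivative.
Arguments is_total_derivative {T W} M U P u theta D.
Arguments totally_pathwise_differentiable {T W} M U P u theta.
Arguments total_derivative {T W} M U P u theta.

(* Such an [A] is unique, and exists by the Riesz representation theorem when
   [D] is linear and continuous on the closed subspace [H].
   The L2(P) (+) T inner product is spelled out because the norm that the
   library puts on a product is the sup norm. *)
Definition is_hermitian_adjoint (T W : hilbertType R) (P : prob)
    (H : set (L2 P * T)) (D : L2 P * T -> W) (A : W -> L2 P * T) : Prop :=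
  forall w, H (A w) /\
    forall h, H h -> inner (A w).1 h.1 + inner (A w).2 h.2 = inner w (D h).

Definition hermitian_adjoint (T W : hilbertType R) (P : prob)
    (H : set (L2 P * T)) (D : L2 P * T -> W) : W -> L2 P * T :=
  get (is_hermitian_adjoint H D).

Definition uniformly_totally_pathwise_differentiable (Y : metricType R)
    (T : hilbertType R) (M : set prob) (U : set T) (F : Y -> prob -> T -> R^o)
    (y0 : Y) (P : prob) (u : T) : Prop :=
  (\forall y \near y0, totally_pathwise_differentiable M U P u (F y)) /\
  forall s t, tangent_set P M s -> direction_set u U t ->
  forall Pe ue, score_paths M s Pe -> direction_paths u U t ue ->
    (F z.1 (Pe z.2) (ue z.2) - F z.1 P u) / z.2
      - total_derivative M U P u (F z.1) (s, t)
      @[z --> filter_prod (nbhs y0) (0 : R)^'+] --> (0 : R).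

(* Neighborhoods of [p] in the subspace M x U of the product of the Hellinger
   and norm topologies, as traces of neighborhoods in the ambient product. *)
Definition model_nbhs (T : hilbertType R) (M : set prob) (U : set T)
    (p : prob * T) : set_system (prob * T) :=
  within (M `*` U) (filter_prod (hellinger_nbhs p.1) (nbhs p.2)).

End tangent.
Arguments tangent_space {d Z R} P M.
Arguments tangent_sum {d Z R T} M U P u.
Arguments total_derivative {d Z R T W} M U P u theta.
Arguments totally_pathwise_differentiable {d Z R T W} M U P u theta.
Arguments is_total_derivative {d Z R T W} M U P u theta D.

(* Main.v *)
(* Along a path with scores (s, t) the minimal value expands as
   [F y0 P u + e * D + o(e)], where [D] is the derivative of [F y0] in direction
   (s, t) (Danskin): the upper bound evaluates at y0, the lower bound holds for
   all y at once by compactness of Y.  Continuity (v) enters because quadratic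
   mean differentiable paths converge in the Hellinger metric.  Derivatives are
   determined on the tangent space by density of the linear spans, which settles
   the choice made by [total_derivative] and [hermitian_adjoint]. *)
Require Import Defs.
From HB Require Import structures.
From mathcomp Require Import all_boot all_order all_algebra.
From mathcomp Require Import all_classical all_reals all_analysis.
From mathcomp Require Import measurable_realfun ring lra.
Import Order.TTheory GRing.Theory Num.Theory.
Import numFieldNormedType.Exports.
Local Open Scope classical_set_scope.
Local Open Scope ring_scope.

(** * Square integrability and change of variables for root densities *)

Section square_integrable.
Set Implicit Arguments.
Unset Strict Implicit.
Context d (Z : measurableType d) (R : realType).

Definition square_integrable (mu : {measure set Z -> \bar R}) (f : Z -> R) :=
  measurable_fun setT f /\
  mu.-integrable setT (EFin \o (fun z => f z ^+ 2)).

Lemma square_integrableB (mu : {measure set Z -> \bar R}) (f g : Z -> R) :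
  square_integrable mu f -> square_integrable mu g ->
  square_integrable mu (fun z => f z - g z).
Proof.
move=> [mf jf] [mg jg]; have mfg := measurable_funB mf mg; split=> //.
(* The dominating function comes from (f - g)^2 + (f + g)^2 = 2 (f^2 + g^2). *)
have jfg : mu.-integrable setT (EFin \o (fun z => 2 * (f z ^+ 2 + g z ^+ 2))).
  exact: integrableZl (integrableD measurableT jf jg).
apply: (le_integrable measurableT _ _ jfg) => [|z _ /=].
  by apply/measurable_EFinP; exact: measurable_funX.
rewrite lee_fin ger0_norm ?sqr_ge0// ger0_norm;
  last by rewrite mulr_ge0 ?addr_ge0 ?sqr_ge0.
have := sqr_ge0 (f z + g z); nra.
Qed.

Lemma square_integrableZ (mu : {measure set Z -> \bar R}) (a : R) (f : Z -> R) :
  square_integrable mu f -> square_integrable mu (fun z => a * f z).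
Proof.
move=> [mf jf]; split; first exact: measurable_funM.
have := integrableZl measurableT (a ^+ 2) jf.
by apply: eq_integrable => // z _ /=; rewrite exprMn EFinM.
Qed.

Lemma square_integrable_L2 (P : {measure set Z -> \bar R}) (s : L2 P) :
  square_integrable P (L2_fun s).
Proof.
split; first exact: (@measurable_funPT _ _ _ _ (L2_mfun s)).
by apply: eq_integrable (L2_integrableM s s) => // z _ /=; rewrite expr2.
Qed.

Lemma measurable_root_density (P : {finite_measure set Z -> \bar R})
    (mu : {sigma_finite_measure set Z -> \bar R}) : P `<< mu ->
  measurable_fun setT (root_density P mu).
Proof.
move=> Pmu; rewrite /root_density.
apply: (@measurableT_comp _ _ _ _ _ _ (@Num.sqrt R)).
  apply: continuous_measurable_fun; exact: sqrt_continuous.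
exact: (measurableT_comp (fine_measurable _)).
Qed.

Lemma integral_root_density (P : {finite_measure set Z -> \bar R})
    (mu : {sigma_finite_measure set Z -> \bar R}) (f : Z -> R) :
  P `<< mu -> measurable_fun setT f ->
  (\int[mu]_z ((f z * root_density P mu z) ^+ 2)%:E =
   \int[P]_z ((f z) ^+ 2)%:E)%E.
Proof.
move=> Pmu mf; have mr := measurable_root_density Pmu.
rewrite -(@Radon_Nikodym_SigmaFinite.change_of_variables _ _ _ P mu Pmu) //;
  last 2 first.
- by move=> z; rewrite lee_fin sqr_ge0.
- by apply/measurable_EFinP; exact: measurable_funX.
apply: ae_eq_integral => //.
- by apply/measurable_EFinP/measurable_funX/measurable_funM.
- apply: emeasurable_funM.
    by apply/measurable_EFinP; exact: measurable_funX.
  exact: (measurable_int _ (@Radon_Nikodym_SigmaFinite.f_integrable _ _ _ P mu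
    Pmu)).
(* [root_density] is built from the derivative of [P] seen as a charge. It agrees almost everywhere
   with the derivative of the measure, which is nonnegative and finite at every point, so squaring
   the root recovers it. *)
apply: filterS (@ae_eq_Radon_Nikodym_SigmaFinite _ _ _ P mu Pmu _ measurableT)
  => z /(_ I) E _.
have := @Radon_Nikodym_SigmaFinite.f_ge0 _ _ _ P mu Pmu z.
have := @Radon_Nikodym_SigmaFinite.f_fin_num _ _ _ P mu Pmu z.
rewrite /root_density -E exprMn => /fineK <-; rewrite lee_fin => f0.
by rewrite sqr_sqrtr// EFinM.
Qed.

Lemma square_integrable_root_density (P : {finite_measure set Z -> \bar R})
    (mu : {sigma_finite_measure set Z -> \bar R}) (f : Z -> R) :
  P `<< mu -> square_integrable P f ->
  square_integrable mu (fun z => f z * root_density P mu z).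
Proof.
move=> Pmu [mf jf]; have mr := measurable_root_density Pmu.
split; first exact: measurable_funM.
apply/integrableP; split.
  by apply/measurable_EFinP/measurable_funX/measurable_funM.
have /integrableP[_] := jf.
under eq_integral do rewrite /= ger0_norm ?sqr_ge0//.
rewrite -(integral_root_density Pmu mf).
by under [in X in _ -> X]eq_integral do rewrite /= ger0_norm ?sqr_ge0//.
Qed.

End square_integrable.

(** * Hellinger convergence of quadratic mean differentiable paths *)

Section scores.
Set Implicit Arguments.
Unset Strict Implicit.
Context d (Z : measurableType d) (R : realType).
Implicit Types (P Q : probability Z R) (M : set (probability Z R)).

Lemma dom_measure_dominates P Q :
  P `<< dom_measure P Q /\ Q `<< dom_measure P Q.
Proof.
by split=> A A0 B mB BA; move: (A0 B mB BA);
  rewrite /dom_measure /= measure_addE => /eqP;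
  rewrite padde_eq0// => /andP[/eqP ? /eqP ?].
Qed.

(** Moves the linear term of the expansion back to [P], so that its size no longer depends on [Q],
    which varies along a path together with the dominating measure. *)
Lemma Rintegral_score P Q (s : L2 P) (e : R) :
  \int[dom_measure P Q]_z
    (e / 2 * L2_fun s z * root_density P (dom_measure P Q) z) ^+ 2
  = (e / 2) ^+ 2 * \int[P]_z (L2_fun s z) ^+ 2.
Proof.
have [PQ _] := dom_measure_dominates P Q.
have [ms js] := square_integrable_L2 s.
rewrite -RintegralZl//; congr fine.
rewrite integral_root_density//; last exact: measurable_funM.
by apply: eq_integral => z _; rewrite exprMn.
Qed.

Lemma hellinger_sq_le P Q (s : L2 P) (e : R) :
  hellinger P Q ^+ 2 <=
  2 * qmd_remainder s e Q + 2 * ((e / 2) ^+ 2 * \int[P]_z (L2_fun s z) ^+ 2).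
Proof.
have [PQ QQ] := dom_measure_dominates P Q.
rewrite /hellinger sqr_sqrtr; last first.
  by apply: Rintegral_ge0 => z _; exact: sqr_ge0.
rewrite -(Rintegral_score Q) /qmd_remainder.
set mu := dom_measure P Q; set p := root_density P mu;
  set q := root_density Q mu.
have one (P' : probability Z R) : square_integrable P' (fun=> 1).
  split; first exact: measurable_cst.
  have := finite_measure_integrable_cst P' 1 measurableT.
  by apply: eq_integrable => // z _ /=; rewrite expr1n.
have Ip : square_integrable mu p.
  have := square_integrable_root_density PQ (one P).
  by congr square_integrable; apply/funext => z; rewrite mul1r.
have Iq : square_integrable mu q.
  have := square_integrable_root_density QQ (one Q).
  by congr square_integrable; apply/funext => z; rewrite mul1r.
have Is : square_integrable mu (fun z => e / 2 * L2_fun s z * p z).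
  apply: square_integrable_root_density => //.
  exact/square_integrableZ/square_integrable_L2.
have [mr jr] := square_integrableB (square_integrableB Iq Ip) Is.
have [_ jpq] := square_integrableB Ip Iq.
have [_ js] := Is.
rewrite -!RintegralZl// -RintegralD//; last 2 first.
- exact: integrableZl jr.
- exact: integrableZl js.
apply: le_Rintegral => // [|z _].
  have := integrableD measurableT (integrableZl measurableT 2 jr)
    (integrableZl measurableT 2 js).
  exact.
set a := e / 2 * _ * _.
(* With r = q - p - a, the gap 2 r^2 + 2 a^2 - (r + a)^2 is the square (r - a)^2. *)
have := sqr_ge0 (q z - p z - a - a); nra.
Qed.

Lemma score_paths_hellinger P M (s : L2 P) (Pe : R -> probability Z R) :
  score_paths M s Pe -> hellinger P (Pe e) @[e --> 0^'+] --> (0 : R).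
Proof.
move=> [_ _ qmd].
pose c := \int[P]_z (L2_fun s z) ^+ 2.
(* This is the bound of [hellinger_sq_le], with the remainder divided and multiplied by e^2 to
   expose the quotient that [qmd] sends to 0. *)
have cvg0 : 2 * (qmd_remainder s e (Pe e) / e ^+ 2 * (e * e))
    + 2 * (e / 2 * (e / 2) * c) @[e --> (0:R)^'+] --> (0 : R).
  have e0 : (e : R) @[e --> 0^'+] --> (0 : R) by exact: cvg_within.
  rewrite [X in _ --> X](_ : 0 = 2 * (0 * (0 * 0)) + 2 * (0 / 2 * (0 / 2) * c));
    last by ring.
  apply: cvgD; apply: cvgM; try exact: cvg_cst.
    by do 2!apply: cvgM => //.
  apply: cvgM; last exact: cvg_cst.
  by apply: cvgM; apply: cvgM => //; exact: cvg_cst.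
have sq0 : hellinger P (Pe e) ^+ 2 @[e --> 0^'+] --> (0 : R).
  apply: (@squeeze_cvgr _ _ _ _ (fun=> 0) _ _ _ _ _ cvg0); last exact: cvg_cst.
  near=> e; rewrite sqr_ge0/=.
  have e_neq0 : e != 0 by near: e; exact: nbhs_right_neq.
  by rewrite -!expr2 divfK ?expf_neq0//; exact: hellinger_sq_le.
have := cvg_comp _ _ sq0 (@sqrt_continuous R 0).
rewrite sqrtr0; apply: cvg_trans; apply: near_eq_cvg; near=> e.
by rewrite /= sqrtr_sqr ger0_norm// sqrtr_ge0.
Unshelve. all: by end_near. Qed.

(** The constant path has score 0. This makes the pairs (0, t) admissible, so the two components of
    a derivative can be tested separately. *)
Lemma tangent_set0 P M : M P -> tangent_set P M 0.
Proof.
move=> MP; exists (fun=> P); split => //.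
have -> : (fun e : R => qmd_remainder (0 : L2 P) e P / e ^+ 2) = fun=> 0.
  apply/funext => e; rewrite /qmd_remainder.
  under eq_Rintegral do rewrite subrr sub0r sqrrN.
  rewrite Rintegral_score (_ : Rintegral _ _ _ = 0) ?mulr0 ?mul0r//.
  (* A representative of the class 0 vanishes only almost everywhere, so the integral is read off
     the norm of 0. *)
  transitivity (inner (0 : L2 P) (0 : L2 P)).
    by apply: eq_Rintegral => z _; rewrite expr2.
  by rewrite inner_norm normr0 expr0n.
exact: cvg_cst.
Qed.

Lemma hellinger_refl P : hellinger P P = 0.
Proof.
rewrite /hellinger; under eq_Rintegral do rewrite subrr expr0n/=.
by rewrite Rintegral_cst// mul0r sqrtr0.
Qed.

End scores.

(** * Induction over linear spans *)

Section linear_span.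
Set Implicit Arguments.
Unset Strict Implicit.
Context (R : realType) (V : normedModType R).
Implicit Types A K : set V.

Lemma linear_span0 A : linear_span A 0.
Proof.
by exists 0, (fun=> 0), (fun=> 0); split => [[]//|]; rewrite big_ord0.
Qed.

Lemma linear_spanZD A a x y : A x -> linear_span A y ->
  linear_span A (a *: x + y).
Proof.
move=> Ax [n [b [v [Av ->]]]].
exists n.+1, (fun i => oapp b a (unlift ord0 i)),
  (fun i => oapp v x (unlift ord0 i)).
split=> [i|]; first by case: unliftP => [j|] _ /=.
by rewrite big_ord_recl unlift_none; congr +%R; apply: eq_bigr => i _;
  rewrite liftK.
Qed.

(** Generators are peeled off one at a time, which suits derivatives: they are prescribed on
    generators and propagate by linearity. *)
Lemma linear_span_ind A K :
  K 0 -> (forall a x y, A x -> K y -> K (a *: x + y)) -> linear_span A `<=` K.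
Proof.
move=> K0 KD _ [n [a [v [Av ->]]]]; elim: n a v Av => [|n IH] a v Av.
  by rewrite big_ord0.
by rewrite big_ord_recl; apply: KD => //; apply: IH => i; exact: Av.
Qed.

Lemma sub_linear_span A : A `<=` linear_span A.
Proof.
by move=> x Ax; rewrite -[x]scale1r -[_ *: _]addr0; apply: linear_spanZD => //;
  exact: linear_span0.
Qed.

End linear_span.

(** * Uniqueness of the total derivative on the tangent space *)

Section uniqueness.
Set Implicit Arguments.
Unset Strict Implicit.
Context d (Z : measurableType d) (R : realType) (T W : hilbertType R).
Implicit Types (P : probability Z R) (M : set (probability Z R)).
Implicit Types (u t : T) (U : set T).

Lemma direction_set0 u U : U u -> direction_set u U 0.
Proof.
move=> Uu; exists (fun=> u); split => //.
rewrite (_ : (fun _ => _) = fun=> 0); first exact: cvg_cst.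
by apply/funext => e; rewrite subrr scaler0 subr0 normr0 mul0r.
Qed.

Lemma sub_closure_setX (V1 V2 : topologicalType) (A : set V1) (B : set V2) x :
  closure A x.1 -> closure B x.2 -> closure (A `*` B) x.
Proof.
move=> Ax Bx C [[C1 C2] /= [nC1 nC2] sC].
have [a [Aa Ca]] := Ax _ nC1; have [b [Bb Cb]] := Bx _ nC2.
by exists (a, b); split => //; exact: sC.
Qed.

(** Every neighborhood of a point [h] of [H] meets [S], where [D1 - D2] vanishes. As [S] lies in
    [H], continuity relative to [H] applies there and forces the norm of [D1 h - D2 h] below every e
    > 0. *)
Lemma eq_on_closure (V : topologicalType) (H S : set V) (D1 D2 : V -> W) :
  {within H, continuous D1} -> {within H, continuous D2} ->
  S `<=` H -> {in S, D1 =1 D2} -> H `<=` closure S -> {in H, D1 =1 D2}.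
Proof.
move=> c1 c2 SH eqS HS h; rewrite inE => Hh.
apply/eqP; rewrite -subr_eq0 -normr_le0; apply/ler_addgt0Pl => e e0;
  rewrite addr0.
have c : (D1 x - D2 x) @[x --> within H (nbhs h)] --> D1 h - D2 h.
  move/subspace_continuousP : c1 => /(_ _ Hh) c1.
  by move/subspace_continuousP : c2 => /(_ _ Hh) c2; exact: cvgB.
move/cvgrPdist_lt : c => /(_ _ e0) nH.
have [x [Sx /(_ (SH _ Sx))]] := HS _ Hh _ nH.
by rewrite (eqS x) ?inE// subrr subr0 => /ltW.
Qed.

(** Paths determine the value on pairs of directions. Linearity extends this to (s, 0) and (0, t)
    over each span, then to sums of these, and continuity to the closures. *)
Lemma total_derivative_unique M U P u (theta : probability Z R -> T -> W)
    (D1 D2 : L2 P * T -> W) : M P -> U u ->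
  is_total_derivative M U P u theta D1 ->
  is_total_derivative M U P u theta D2 ->
  {in tangent_sum M U P u, D1 =1 D2}.
Proof.
move=> MP Uu [l1 c1 d1] [l2 c2 d2].
have S0 := tangent_set0 MP; have T0 := direction_set0 Uu.
have eqST s t : tangent_set P M s -> direction_set u U t ->
  D1 (s, t) = D2 (s, t).
  move=> Ss Tt; have [Pe sPe] := Ss; have [ue tue] := Tt.
  (* Both remainders along one common path are o(e), and by the triangle inequality their sum bounds
     e times the distance between the two values. *)
  have : `|theta (Pe e) (ue e) - theta P u - e *: D1 (s, t)| / e +
      `|theta (Pe e) (ue e) - theta P u - e *: D2 (s, t)| / e
      @[e --> 0^'+] --> (0 + 0 : R) by apply: cvgD; [exact: d1|exact: d2].
  rewrite addr0 => /cvgrPdist_le cD.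
  apply/eqP; rewrite -subr_eq0 -normr_le0; apply/ler_addgt0Pl => r r0;
    rewrite addr0.
  near (0 : R)^'+ => e.
  have e0 : 0 < e by near: e; exact: nbhs_right_gt.
  have : `|0 - (`|theta (Pe e) (ue e) - theta P u - e *: D1 (s, t)| / e +
      `|theta (Pe e) (ue e) - theta P u - e *: D2 (s, t)| / e)| <= r.
    by near: e; exact: cD.
  rewrite sub0r normrN ger0_norm;
    last by rewrite addr_ge0 ?divr_ge0 ?normr_ge0 ?ltW.
  rewrite -mulrDl ler_pdivrMr//.
  set x := theta (Pe e) (ue e) - theta P u => xr.
  rewrite -(ler_pM2r e0); apply: le_trans xr.
  rewrite -{1}(gtr0_norm e0) mulrC -normrZ scalerBr.
  rewrite (_ : _ - _ = (x - e *: D2 (s, t)) - (x - e *: D1 (s, t))).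
    by rewrite [leRHS]addrC; exact: ler_normB.
  by rewrite opprB [RHS]addrC addrA subrK.
set A := tangent_set P M in S0 *; set B := direction_set u U in T0 *.
have HAB s t : linear_span A s -> linear_span B t -> tangent_sum M U P u (s, t).
  by move=> As Bt; split; exact: subset_closure.
have Z0 : linear_span A 0 by exact: linear_span0.
have Z1 : linear_span B 0 by exact: linear_span0.
have eqA s : linear_span A s -> D1 (s, 0) = D2 (s, 0).
  (* Span membership is carried through the induction because [D1] and [D2] are linear only on the
     tangent sum. *)
  suff : linear_span A `<=` [set s | linear_span A s /\ D1 (s, 0) = D2 (s, 0)].
    by move=> sub /sub[].
  apply: linear_span_ind => [|a x y Ax [Ay eqy]] /=.
    by split => //; exact: eqST.
  split; first exact: linear_spanZD.
  have Lx := sub_linear_span Ax.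
  have -> : (a *: x + y, 0 : T) = a *: (x, 0) + (y, 0) :> L2 P * T.
    by congr pair; rewrite /= scaler0 addr0.
  by rewrite l1 ?l2 ?eqy ?eqST//; exact: HAB.
have eqB t : linear_span B t -> D1 (0, t) = D2 (0, t).
  suff : linear_span B `<=` [set t | linear_span B t /\ D1 (0, t) = D2 (0, t)].
    by move=> sub /sub[].
  apply: linear_span_ind => [|a x y Ax [Ay eqy]] /=.
    by split => //; exact: eqST.
  split; first exact: linear_spanZD.
  have Lx := sub_linear_span Ax.
  have -> : (0 : L2 P, a *: x + y) = a *: (0, x) + (0, y) :> L2 P * T.
    by congr pair; rewrite /= scaler0 addr0.
  by rewrite l1 ?l2 ?eqy ?eqST//; exact: HAB.
apply: (@eq_on_closure _ _ (linear_span A `*` linear_span B)) => //.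
- by move=> [s t] [/= As Bt]; exact: HAB.
- move=> [s t]; rewrite inE => -[/= As Bt].
  have -> : (s, t) = 1 *: (s, 0) + (0, t) :> L2 P * T.
    by congr pair; rewrite /= scale1r ?addr0 ?add0r.
  by rewrite l1 ?l2 ?eqA ?eqB//; exact: HAB.
- by move=> h [hA hB]; exact: sub_closure_setX.
Unshelve. all: by end_near. Qed.

End uniqueness.

(** * Convergence of paths in the topology of the model *)

Section paths.
Set Implicit Arguments.
Unset Strict Implicit.
Context d (Z : measurableType d) (R : realType) (T : hilbertType R).
Implicit Types (P : probability Z R) (M : set (probability Z R)).
Implicit Types (u t : T) (U : set T).

Lemma direction_paths_cvg u U t (ue : R -> T) :
  direction_paths u U t ue -> ue e @[e --> 0^'+] --> u.
Proof.
move=> [_ due].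
have e0 : (e : R) @[e --> 0^'+] --> (0 : R) by exact: cvg_within.
have c : `|ue e - u - e *: t| / e * e + e * `|t| @[e --> 0^'+] --> (0 : R).
  rewrite [X in _ --> X](_ : 0 = 0 * 0 + 0 * `|t|); last by ring.
  by apply: cvgD; apply: cvgM => //; exact: cvg_cst.
apply/cvgrPdist_lt => r r0; move/cvgrPdist_lt : c => /(_ _ r0) c.
near=> e.
have e_gt0 : 0 < e by near: e; exact: nbhs_right_gt.
have : `|0 - (`|ue e - u - e *: t| / e * e + e * `|t|)| < r by near: e.
rewrite sub0r normrN divfK ?gt_eqF// => H;
  apply: le_lt_trans (le_lt_trans (ler_norm _) H).
rewrite (_ : e * `|t| = `|e *: t|) 1?distrC; last by rewrite normrZ gtr0_norm.
by rewrite -{1}(subrK (e *: t) (ue e - u)); exact: ler_normD.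
Unshelve. all: by end_near. Qed.

Lemma near_path_model M U P u (s : L2 P) t
    (Pe : R -> probability Z R) (ue : R -> T) :
  score_paths M s Pe -> direction_paths u U t ue ->
  \forall e \near 0^'+, M (Pe e) /\ U (ue e).
Proof.
move=> [MPe _ _] [Uue _]; near=> e.
have e01 : 0 <= e <= 1.
  by apply/andP; split; near: e; [exact: nbhs_right_ge|exact: nbhs_right_le].
by split; [exact: MPe|exact: Uue].
Unshelve. all: by end_near. Qed.

(** Hellinger convergence and norm convergence handle the two factors. Since [model_nbhs] consists
    of traces on [M] x [U], the path must also stay in the model, which it does for e in [0, 1]. *)
Lemma path_model_nbhs M U P u (s : L2 P) t
    (Pe : R -> probability Z R) (ue : R -> T) :
  score_paths M s Pe -> direction_paths u U t ue ->
  (Pe e, ue e) @[e --> 0^'+] --> model_nbhs M U (P, u).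
Proof.
move=> sPe tue A [[A1 A2] /= [[r r0 rA1] nA2] sA].
have /cvgrPdist_lt /(_ _ r0) hP := score_paths_hellinger sPe.
have hu := direction_paths_cvg tue nA2.
suff : \forall e \near 0^'+, A (Pe e, ue e) by [].
near=> e.
have MU : M (Pe e) /\ U (ue e) by near: e; exact: near_path_model sPe tue.
apply: (sA (Pe e, ue e) _ MU); split; last by near: e.
apply: rA1 => /=; apply: le_lt_trans (ler_norm _) _; rewrite -normrN -sub0r.
by near: e.
Unshelve. all: by end_near. Qed.

Lemma model_nbhs_self M U P u N : M P -> U u -> model_nbhs M U (P, u) N ->
  N (P, u).
Proof.
move=> MP Uu [[A1 A2] /= [[r r0 rA1] nA2] sA];
  apply: (sA (P, u) _ (conj MP Uu)); split => /=.
  by apply: rA1; rewrite /= hellinger_refl.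
exact: nbhs_singleton nA2.
Qed.

End paths.

(** * First-order expansion of an infimum over a compact set *)

Section envelope.
Set Implicit Arguments.
Unset Strict Implicit.

(* Off [y0] the slack [g y - g y0 > 0] absorbs the linear term, at [y0] the
   uniform expansion applies; compactness of Y makes both uniform in y, so no
   minimizer of [f ^~ e] has to be selected. *)
Lemma envelope_cvg (R : realType) (Y : topologicalType) (f : Y -> R -> R)
    (g : Y -> R) (v : R -> R) (y0 : Y) (D : R) :
  compact [set: Y] ->
  (\forall e \near 0^'+,
    (v e)%:E = ereal_inf [set (f y e)%:E | y in [set: Y]]) ->
  (forall y, y != y0 -> g y0 < g y /\
     f z.1 z.2 @[z --> filter_prod (nbhs y) (0 : R)^'+] --> g y) ->
  (f z.1 z.2 - g z.1) / z.2 @[z --> filter_prod (nbhs y0) (0 : R)^'+] --> D ->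
  `|v e - g y0 - e * D| / e @[e --> 0^'+] --> (0 : R).
Proof.
move=> cptY v_inf f_off f_y0; apply/cvgrPdist_le => r r0.
have near0 : \forall z \near filter_prod (nbhs y0) (0 : R)^'+,
    `|D - (f z.1 z.2 - g z.1) / z.2| <= r.
  by move/cvgrPdist_le : f_y0; exact.
have lower : \forall e \near 0^'+,
  [set: Y] `<=` [set y | g y0 + e * (D - r) <= f y e].
  move/compact_near_coveringP : cptY; apply => y _.
  have [->|yy0] := eqVneq y y0.
    case: near0 => -[A B] /= [nA nB] sAB.
    exists (A, [set e | 0 < e] `&` B) => [|[y' e] [/= Ay' [e0 Be]]].
      by split => //=; apply: filterI => //; exact: nbhs_right_gt.
    have /= := sAB (y', e) (conj Ay' Be).
    rewrite ler_norml => /andP[_]; rewrite lerBlDl -lerBlDr ler_pdivlMr// => h.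
    (* The expansion near [y0] is centred at [g y']; minimality of [y0] lets [g y0] replace it in a
       lower bound. *)
    have : g y0 <= g y' by have [->//|/f_off[/ltW]] := eqVneq y' y0.
    lra.
  have [lty cy] := f_off y yy0.
  have lt_mid : (g y0 + g y) / 2 < g y by lra.
  have [[A B] /= [nA nB] sAB] := cvgr_ge (g y) cy _ lt_mid.
  (* Below this threshold e (|D| + 1) is less than half the gap, so [g y0 + e * (D - r)] stays under
     the midpoint of [g y0] and [g y], while f stays above it. The + 1 keeps the denominator
     positive when D = 0. *)
  have c0 : 0 < (g y - g y0) / 2 / (`|D| + 1).
    by rewrite !divr_gt0 ?subr_gt0// ltr_wpDl.
  exists (A, [set e | 0 < e] `&` ([set e | e < (g y - g y0) / 2 / (`|D| + 1)]
    `&` B)).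
    split => //=; apply: filterI; first exact: nbhs_right_gt.
    by apply: filterI => //; exact: nbhs_right_lt.
  move=> [y' e] [/= Ay' [e0 [elt Be]]].
  have /= := sAB (y', e) (conj Ay' Be).
  move: elt; rewrite ltr_pdivlMr ?ltr_wpDl// => elt.
  have : e * (D - r) <= e * (`|D| + 1).
    by rewrite ler_pM2l//; have := ler_norm D; lra.
  by lra.
have upper : \forall e \near 0^'+, f y0 e - g y0 <= e * (D + r).
  case: near0 => -[A B] /= [nA nB] sAB.
  near=> e.
  have e0 : 0 < e by near: e; exact: nbhs_right_gt.
  have Be : B e by near: e.
  have /= := sAB (y0, e) (conj (nbhs_singleton nA) Be).
  by rewrite ler_norml => /andP[+ _];
    rewrite lerBrDl -lerBrDr opprK ler_pdivrMr// mulrC.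
near=> e.
have e0 : 0 < e by near: e; exact: nbhs_right_gt.
have vE : (v e)%:E = ereal_inf [set (f y e)%:E | y in [set: Y]] by near: e.
have ve_le : v e <= f y0 e.
  by rewrite -lee_fin vE; apply: ereal_inf_lbound; exists y0.
have le_ve : g y0 + e * (D - r) <= v e.
  rewrite -lee_fin vE; apply: le_ereal_inf_tmp => _ [y _ <-]; rewrite lee_fin.
  have : [set: Y] `<=` [set y | g y0 + e * (D - r) <= f y e] by near: e.
  exact.
have le_up : f y0 e - g y0 <= e * (D + r) by near: e.
rewrite sub0r normrN ger0_norm; last by rewrite divr_ge0 ?normr_ge0// ltW.
rewrite ler_pdivrMr// ler_norml; apply/andP; split; nra.
Unshelve. all: by end_near. Qed.

End envelope.

(** * Derivative and adjoint of the infimum over the model *)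

Theorem lemmaS13 (R : realType) (d : measure_display) (Z : measurableType d)
    (M : set (probability Z R)) (T : hilbertType R) (U : set T)
    (Y : metricType R) (F : Y -> probability Z R -> T -> R^o)
    (theta : probability Z R -> T -> R^o)
    (theta_inf : forall P' u', M P' -> U u' ->
       (theta P' u')%:E = ereal_inf [set (F y P' u')%:E | y in [set: Y]])
    (P : probability Z R) (u : T) (MP : M P) (Uu : U u)
    (M_nonparam : locally_nonparametric P M)
    (Y_compact : compact [set: Y])
    (y0 : Y) (y0_argmin : unique (fun y => theta P u = F y P u) y0)
    (F_diff : uniformly_totally_pathwise_differentiable M U F y0 P u)
    (F_diff_cont : forall s t, tangent_set P M s -> direction_set u U t ->
       {for y0, continuous (fun y => total_derivative M U P u (F y) (s, t))})
    (F_cont : exists N : set (probability Z R * T),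
       [/\ N `<=` M `*` U, model_nbhs M U (P, u) N &
         forall y p, N p ->
           F z.1 z.2.1 z.2.2 @[z --> filter_prod (nbhs y)
                                 (within N (model_nbhs M U p))]
             --> F y p.1 p.2]) :
  [/\ totally_pathwise_differentiable M U P u theta,
      {in tangent_sum M U P u,
        total_derivative M U P u theta =1 total_derivative M U P u (F y0)} &
      hermitian_adjoint (tangent_sum M U P u) (total_derivative M U P u theta)
      = hermitian_adjoint (tangent_sum M U P u)
          (total_derivative M U P u (F y0))].
Proof.
have [F_near F_unif] := F_diff.
have [N [NMU nN N_cont]] := F_cont.
have theta_y0 : theta P u = F y0 P u by have [] := y0_argmin.
have D0 : is_total_derivative M U P u (F y0) (total_derivative M U P u (F y0)).
  exact: (getPex (nbhs_singleton F_near)).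
have [D0_lin D0_cont _] := D0.
have D_theta : is_total_derivative M U P u theta
    (total_derivative M U P u (F y0)).
  split=> // s t Ss Tt Pe ue sPe tue; rewrite theta_y0.
  apply: (@envelope_cvg R Y (fun y e => F y (Pe e) (ue e)) (fun y => F y P u)
    (fun e => theta (Pe e) (ue e)) y0) => //.
  - apply: filterS (near_path_model sPe tue) => e [MPe Uue].
    exact: theta_inf.
  - move=> y yy0; split.
      rewrite lt_neqAle -theta_y0; apply/andP; split.
        (* Equality would make [y] a second minimizer, so uniqueness yields the strict gap. *)
        by apply: contra_neq yy0 => /y0_argmin.2.
      by rewrite -lee_fin theta_inf//; apply: ereal_inf_lbound; exists y.
    move=> A /(N_cont y (P, u) (model_nbhs_self MP Uu nN))
      [[B1 B2] /= [nB1 nB2] sB].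
    (* Continuity is available only within [N]; the path enters [N] eventually, which discharges the
       premise attached to [B2]. *)
    have nB : \forall e \near 0^'+,
        N (Pe e, ue e) /\ (N (Pe e, ue e) -> B2 (Pe e, ue e)).
      apply: filterI; first exact: (path_model_nbhs sPe tue nN).
      exact: (path_model_nbhs sPe tue nB2).
    exists (B1, [set e | B2 (Pe e, ue e)]).
      by split => //=; apply: filterS nB => e [? ]; exact.
    by move=> [y' e] [/= B1y B2e]; exact: (sB (y', (Pe e, ue e))).
  (* The uniform expansion subtracts the derivative of [F y] for moving y. Continuity of that
     derivative at [y0] turns it into the single limit attached to [F y0]. *)
  - have cD : total_derivative M U P u (F z.1) (s, t)
        @[z --> filter_prod (nbhs y0) (0 : R)^'+]
        --> total_derivative M U P u (F y0) (s, t).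
      apply: (cvg_comp _ (fun y => total_derivative M U P u (F y) (s, t))
        cvg_fst).
      exact: F_diff_cont.
    rewrite -[X in _ --> X]add0r.
    have := F_unif s t Ss Tt Pe ue sPe tue.
    move=> /cvgD/(_ cD); apply: cvg_trans; apply: near_eq_cvg;
      apply: nearW => z.
    by rewrite /= subrK.
have theta_diff : totally_pathwise_differentiable M U P u theta.
  by exists (total_derivative M U P u (F y0)).
have eqD : {in tangent_sum M U P u,
    total_derivative M U P u theta =1 total_derivative M U P u (F y0)}.
  exact: total_derivative_unique MP Uu (getPex theta_diff) D_theta.
(* [is_hermitian_adjoint] evaluates its operator only on the tangent sum, where the two derivatives
   agree. The two predicates are thus equal and [get] selects the same adjoint. *)
split=> //; congr get; apply/funext => A; apply/propext.
by split=> adj w; have [HA inA] := adj w; split=> // h Hh;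
  rewrite inA// eqD// inE.
Qed.
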